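(* There exist absolute constants $c,C>0$ such that for every metric space $M=(V,d)$ with $|V|=n$ (for $n$ sufficiently large) and every number $k\ge2$, there exists a subset $S\subseteq V$ with $|S|\ge n^{c/\log k}$ such that the metric space $(S,d)$ $(C\log\log n)$-approximates some $k$-HST. (In the paper's notation: $|S|\ge n^{\Omega(1/\log k)}$ and the approximation factor is $O(\log\log n)$.)
   Context: A metric space $(X,d)$ $\alpha$-approximates a metric space $(X,d')$ on the same set if $d'(u,v)\le d(u,v)\le\alpha\, d'(u,v)$ for all $u,v\in X$. For $k\ge1$, a $k$-HST (hierarchically well-separated tree) is a metric space defined on the leaves of a rooted tree $T$, where each vertex $u$ carries a label $\Delta(u)\ge0$ with $\Delta(u)=0$ iff $u$ is a leaf, and if $u$ is a child of $v$ then $\Delta(u)\le\Delta(v)/k$; the distance between leaves $x,y$ is $\Delta(\mathrm{lca}(x,y))$, where $\mathrm{lca}$ is the least common ancestor in $T$. *)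

(* Defs.v *)
From HB Require Import structures.
From mathcomp Require Import all_boot all_order all_algebra.
From mathcomp Require Import all_classical all_reals all_analysis.

Set Implicit Arguments.
Unset Strict Implicit.
Unset Printing Implicit Defensive.

Import Order.TTheory GRing.Theory Num.Theory.
Local Open Scope ring_scope.

#[short(type="finMetricType")]
HB.structure Definition FinMetric (K : numDomainType) :=
  { M of Finite M & Metric K M }.

(* d' <= d <= alpha d' : the metric d alpha-approximates the metric d'. *)
Definition approximates (R : realType) (X : Type) (alpha : R)
    (d d' : X -> X -> R) : Prop :=
  forall u v : X, d' u v <= d u v /\ d u v <= alpha * d' u v.

(* A finite rooted tree, given by its parent function. By convention the root
   is its own parent; [root_reachable] excludes any other cycle. *)
Record rooted_tree := RootedTree {
  vertex :> finType;
  root : vertex;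
  parent : vertex -> vertex;
  parent_root : parent root = root;
  root_reachable : forall v : vertex, fconnect parent v root
}.

Section RootedTree.
Variable T : rooted_tree.
Implicit Types u v a : T.

Definition is_child u v : bool := (u != root T) && (parent u == v).

Definition is_leaf v : bool := [forall u, ~~ is_child u v].

(* [ancestor a v] is reflexive: a vertex is an ancestor of itself. *)
Definition ancestor a v : bool := fconnect (@parent T) v a.

Definition common_ancestor a u v : bool := ancestor a u && ancestor a v.

(* The common ancestor that descends from every other one. It always exists
   (see [lcaP]), so the default value is never used. *)
Definition lca u v : T :=
  odflt (root T)
    [pick a | common_ancestor a u v
            & [forall b, common_ancestor b u v ==> ancestor b a]].

Lemma lcaP u v :
  common_ancestor (lca u v) u v /\
  (forall b, common_ancestor b u v -> ancestor b (lca u v)).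
Proof.
rewrite /lca; case: pickP => [a /andP[ua /forallP le_a]|noa] /=.
  by split=> // b ub; have := le_a b; rewrite ub.
have exi : exists i, ancestor (iter i (@parent T) u) v.
  have /iter_findex ru := root_reachable u.
  by exists (findex (@parent T) u (root T)); rewrite ru; apply: root_reachable.
case: (ex_minnP exi) => i iv mini.
have := noa (iter i (@parent T) u).
rewrite /common_ancestor {1}/ancestor fconnect_iter iv /= => /negP[].
apply/forallP => b; apply/implyP => /andP[ub vb].
have eb := iter_findex ub.
have le_ib : (i <= findex (@parent T) u b)%N by apply: mini; rewrite eb.
by rewrite /ancestor -eb -(subnK le_ib) iterD fconnect_iter.
Qed.

End RootedTree.

Definition hst_labelling (R : realType) (k : R) (T : rooted_tree)
    (Delta : T -> R) : Prop :=
  [/\ forall u, 0 <= Delta u,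
      forall u, Delta u = 0 <-> is_leaf u
    & forall u v, is_child u v -> Delta u <= Delta v / k].

(* (X, d) is a k-HST: [leaf] identifies the points of X with the leaves of a
   labelled rooted tree. *)
Definition is_HST (R : realType) (k : R) (X : Type) (d : X -> X -> R) : Prop :=
  exists (T : rooted_tree) (Delta : T -> R) (leaf : X -> T),
    [/\ hst_labelling k Delta,
        injective leaf,
        forall v : T, is_leaf v <-> exists x : X, leaf x = v
      & forall x y : X, d x y = Delta (lca (leaf x) (leaf y))].

(* Main.v *)
Require Import Defs.
From mathcomp Require Import all_boot all_order all_algebra.
From mathcomp Require Import all_classical all_reals all_analysis.
From mathcomp Require Import ring lra zify.

(** Let D = d(x, y) be the diameter of a cluster X of m <= n points. The balls of
    radius i D / (2 (t + 1)), i <= t, around one of x, y have at most m / 2 points.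
    If t is of order log log n, their sizes cannot grow too fast at every step,
    so for some i the ball A of index i and the complement B of the ball of index
    i + 1 satisfy sqrt|A| + sqrt|B| >= sqrt m, while d(A, B) >= D / (2 (t + 1)).
    Dropping X \ (A u B) and recursing yields an ultrametric with distortion
    O(t) on sqrt n points. To make it a k-HST, round the scales of the splits to
    powers of 2, put b ~ log k, and for every residue r mod b build a set S_r in
    which branching is kept only at scales congruent to r; then
    prod_r |S_r| >= sqrt n by induction, and the largest S_r has at least
    n^(1/(2b)) points. *)

Set Implicit Arguments.
Unset Strict Implicit.
Unset Printing Implicit Defensive.

Import Order.TTheory GRing.Theory Num.Theory.
Local Open Scope ring_scope.

(* An integer-valued ultrametric [L] is turned into a tree whose vertices at
   height [i <= m] are the balls [L x y <= i], each encoded by a chosen element. *)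
Section LevelTree.
Variables (X : finType) (L : X -> X -> nat) (m : nat).
Hypothesis L_eq0 : forall x y, (L x y == 0%N) = (x == y).
Hypothesis L_sym : forall x y, L x y = L y x.
Hypothesis L_ultra : forall y x z, (L x z <= maxn (L x y) (L y z))%N.
Hypothesis L_le : forall x y, (L x y <= m)%N.

(** By the ultrametric inequality every point of a ball is a centre of it, and [pick] depends only
    on the extension of its predicate, so the choice is canonical. The default is never reached, as
    [L x x = 0]. *)
Definition level_rep (i : nat) (x : X) : X :=
  odflt x [pick y | (L x y <= i)%N].

Lemma L_level_rep i x : (L x (level_rep i x) <= i)%N.
Proof.
rewrite /level_rep; case: pickP => [y //|/(_ x)].
by rewrite (eqP (etrans (L_eq0 x x) (eqxx x))).
Qed.

Lemma level_rep_eq i x y : (level_rep i x == level_rep i y) = (L x y <= i)%N.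
Proof.
apply/eqP/idP => [e|xy].
  have := L_ultra (level_rep i x) x y; rewrite {2}e (L_sym (level_rep i y)).
  have := L_level_rep i x; have := L_level_rep i y; lia.
have eP : (fun z => L x z <= i)%N =1 (fun z => L y z <= i)%N.
  move=> z; have := L_ultra x y z; have := L_ultra y x z.
  rewrite (L_sym y x) => *; apply/idP/idP; lia.
rewrite /level_rep (eq_pick eP); case: pickP => [//|/(_ y)].
by rewrite (eqP (etrans (L_eq0 y y) (eqxx y))).
Qed.

Definition level_vertex : finType :=
  {p : 'I_m.+1 * X | level_rep p.1 p.2 == p.2}.

Lemma level_node_subproof (i : nat) (x : X) :
  let j : 'I_m.+1 := inord (minn i m) in
  level_rep j (level_rep j x) == level_rep j x.
Proof. by rewrite /= level_rep_eq L_sym L_level_rep. Qed.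

(** Capping the height at [m] makes the top ball its own parent, the convention for the root in
    [rooted_tree]. *)
Definition level_node (i : nat) (x : X) : level_vertex :=
  exist _ (inord (minn i m), level_rep (inord (minn i m) : 'I_m.+1) x)
    (level_node_subproof i x).

Definition level (p : level_vertex) : nat := (val p).1.

Lemma level_levelnode i x : level (level_node i x) = minn i m.
Proof. by rewrite /level /= inordK // ltnS geq_minr. Qed.

Lemma level_node_eq i x j y :
  (level_node i x == level_node j y) =
  (minn i m == minn j m) && (L x y <= i)%N.
Proof.
rewrite -val_eqE xpair_eqE -val_eqE /= !inordK ?ltnS ?geq_minr //.
case: eqP => //= <-; rewrite level_rep_eq leq_min L_le andbT //.
Qed.

Lemma level_nodeP (p : level_vertex) : p = level_node (level p) (val p).2.
Proof.
case: p => -[i x] h; apply/val_inj; rewrite /= /level /=; have /eqP e := h.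
have -> : inord (minn i m) = i :> 'I_m.+1.
  by apply/val_inj; rewrite /= (minn_idPl (leq_ord i)) inordK.
by rewrite e.
Qed.

Definition level_parent (p : level_vertex) : level_vertex :=
  level_node (level p).+1 (val p).2.

Lemma level_parent_node i x :
  level_parent (level_node i x) = level_node i.+1 x.
Proof.
apply/eqP; rewrite /level_parent level_node_eq level_levelnode.
apply/andP; split; first by apply/eqP; lia.
rewrite /= inordK ?ltnS ?geq_minr // L_sym.
have := L_level_rep (minn i m) x; have := geq_minr i m; lia.
Qed.

Lemma iter_level_parent n i x :
  iter n level_parent (level_node i x) = level_node (n + i) x.
Proof. by elim: n => //= n ->; rewrite level_parent_node. Qed.

Lemma level_node_top i x y : (m <= i)%N -> level_node i x = level_node m y.
Proof.
move=> mi; apply/eqP; rewrite level_node_eq (leq_trans (L_le x y)) // andbT.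
by apply/eqP; lia.
Qed.

Variable x0 : X.

Lemma level_parent_root : level_parent (level_node m x0) = level_node m x0.
Proof. by rewrite level_parent_node; exact: level_node_top. Qed.

Lemma level_root_reachable p : fconnect level_parent p (level_node m x0).
Proof.
rewrite (level_nodeP p) -(level_node_top (val p).2 x0 (leq_addr (level p) m)).
by rewrite -iter_level_parent fconnect_iter.
Qed.

Definition level_tree : rooted_tree :=
  RootedTree level_parent_root level_root_reachable.

Lemma level_rootP (p : level_tree) : (m <= level p)%N -> p = Defs.root level_tree.
Proof. by move=> mp; rewrite (level_nodeP p); exact: level_node_top. Qed.

Lemma level_child (u p : level_tree) :
  is_child u p -> level p = (level u).+1.
Proof.
case/andP=> un /eqP <-; rewrite /= level_levelnode; apply/minn_idPl.
by rewrite ltnNge; apply: contra un => /level_rootP ->.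
Qed.

(** A vertex of height [i.+1] always has a child, the ball of radius [i] about its own centre, even
    if both balls have the same points. *)
Lemma level_leaf (p : level_tree) : is_leaf p = (level p == 0%N).
Proof.
apply/idP/eqP => [lf|p0]; last first.
  by apply/forallP => u; apply/negP => /level_child; rewrite p0.
case e: (level p) => [//|i]; move/forallP/(_ (level_node i (val p).2))/negP: lf.
case; have ltim : (i < m)%N by rewrite -ltnS -e ltn_ord.
apply/andP; split; last by rewrite [parent _]level_parent_node -e -level_nodeP.
rewrite [Defs.root _]/= level_node_eq; apply/nandP; left; lia.
Qed.

Lemma level_ancestor (a : level_tree) (x : X) :
  ancestor a (level_node 0 x : level_tree) <-> exists n, a = level_node n x.
Proof.
split=> [/iter_findex <-|[n ->]].
  by rewrite iter_level_parent addn0; eexists.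
by rewrite -[n]addn0 -iter_level_parent; exact: fconnect_iter.
Qed.

(** The ancestors of a leaf are the balls about its point, and a ball about [x] is also one about
    [y] exactly when its radius reaches [L x y]. *)
Lemma level_lca (x y : X) :
  level (lca (level_node 0 x : level_tree) (level_node 0 y)) = L x y.
Proof.
have [/andP[/level_ancestor[i ->] /level_ancestor[j e]] low] :=
  lcaP (level_node 0 x : level_tree) (level_node 0 y).
have /low /iter_findex : common_ancestor
    (level_node (L x y) x : level_tree) (level_node 0 x) (level_node 0 y).
  apply/andP; split; apply/level_ancestor; first by exists (L x y).
  by exists (L x y); apply/eqP; rewrite level_node_eq eqxx leqnn.
rewrite e iter_level_parent => /eqP; rewrite level_node_eq => /andP[/eqP h _].
move/eqP: e; rewrite level_node_eq => /andP[/eqP ij Lij].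
rewrite level_levelnode; have := L_le x y; move: h ij Lij; lia.
Qed.

End LevelTree.

Lemma level_HST (R : realType) (k : R) (X : finType) (L : X -> X -> nat)
    (v : nat -> R) (x0 : X) :
  v 0%N = 0 -> (forall i, 0 < v i.+1) -> (forall i, v i <= v i.+1 / k) ->
  (forall x y, (L x y == 0%N) = (x == y)) ->
  (forall x y, L x y = L y x) ->
  (forall y x z, (L x z <= maxn (L x y) (L y z))%N) ->
  is_HST k (fun x y => v (L x y)).
Proof.
move=> v0 v_gt0 v_ratio L0 Ls Lu.
pose m := \max_x \max_y L x y.
have Lm x y : (L x y <= m)%N.
  apply: leq_trans (leq_bigmax (F := fun x => \max_y L x y) x).
  exact: (leq_bigmax (F := L x) y).
exists (level_tree L0 Ls Lu Lm x0), (fun p => v (level p)).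
exists (fun x => level_node m L0 Ls Lu 0 x); split.
- split=> [u|u|u p].
  + by case: (level u) => [|i]; rewrite ?v0 // ltW.
  + rewrite level_leaf; case: (level u) => [|i]; first by rewrite v0.
    by split=> // vi; have := v_gt0 i; rewrite vi ltxx.
  + by move/level_child->; exact: v_ratio.
- by move=> x y /eqP; rewrite (level_node_eq _ _ _ Lm) leqn0 L0 => /andP[_ /eqP].
- move=> p; rewrite level_leaf; split=> [/eqP p0|[x <-]].
    by exists (val p).2; rewrite [RHS]level_nodeP p0.
  by rewrite level_levelnode min0n.
- by move=> x y; rewrite level_lca.
Qed.

(* If every step failed, [y i = a i / (2 x)] would satisfy
   [y i.+1 ^ 2 > y i], hence [y t ^ 2 ^ t > 1 / (2 x)] although [y t <= 1/4]. *)
Lemma slow_growth (a : nat -> nat) (x t : nat) :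
  (0 < a 0)%N -> (2 * a t <= x)%N -> (2 * x < 4 ^ (2 ^ t))%N ->
  exists2 i, (i < t)%N & (a i.+1 ^ 2 <= 2 * a i * x)%N.
Proof.
move=> a0 at_le lt_x; apply: contrapT => fast.
have {}fast i : (i < t)%N -> (2 * a i * x < a i.+1 ^ 2)%N.
  by move=> it; rewrite ltnNge; apply/negP => h; apply: fast; exists i.
have a_gt0 i : (i <= t)%N -> (0 < a i)%N.
  by case: i => // i /fast; case: (a i.+1).
(* This is [y i ^ (2 ^ i) >= 1 / (2 x)] with denominators cleared. *)
have grow i : (i <= t)%N -> ((2 * x) ^ (2 ^ i) <= 2 * x * a i ^ (2 ^ i))%N.
  elim: i => [_|i IHi lt_it]; first by rewrite !expn1 leq_pmulr.
  rewrite expnS !expnM.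
  have h : ((2 * a i * x) ^ (2 ^ i) <= (a i.+1 ^ 2) ^ (2 ^ i))%N.
    by rewrite leq_exp2r ?expn_gt0 // ltnW // fast.
  apply: leq_trans (leq_mul (leqnn (2 * x)%N) h).
  rewrite -[((2 * x) ^ 2)%N]/((2 * x) * (2 * x))%N.
  rewrite (_ : (2 * a i * x)%N = (a i * (2 * x))%N); last by lia.
  move: (2 * x)%N IHi => y IHi.
  by rewrite !expnMn mulnA leq_mul2r IHi ?orbT // ltnW.
have := grow t (leqnn t); rewrite leqNgt => /negP; apply.
apply: (@leq_trans (4 ^ (2 ^ t) * a t ^ (2 ^ t))%N).
  by rewrite ltn_mul2r expn_gt0 a_gt0.
by rewrite -expnMn leq_exp2r ?expn_gt0 //; lia.
Qed.

(** * Ultrametric levels on subsets, and separated splits of a cluster *)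

Section Metric.
Variables (R : realType) (V : finMetricType R).
Implicit Types (X A B S : {set V}) (x y : V) (v : nat -> R).
Local Notation d := (@mdist R V).

(** [L] is total on [V] but constrained only on [S], so two such functions can be glued by cases,
    without subtypes. The bound [M] provides a level at which to glue. *)
Definition ultrametric_levels v (alpha : R) (M : nat) S (L : V -> V -> nat) :=
  [/\ {in S &, forall x y, (L x y == 0%N) = (x == y)},
      {in S &, forall x y, L x y = L y x},
      {in S & &, forall x y z, (L x z <= maxn (L x y) (L y z))%N},
      {in S &, forall x y, (L x y <= M)%N}
    & {in S &, forall x y, v (L x y) <= d x y <= alpha * v (L x y)}].

Definition leveled v alpha M S := exists L, ultrametric_levels v alpha M S L.

Lemma leveled1 v alpha M x : v 0%N = 0 -> leveled v alpha M [set x].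
Proof.
move=> v0; exists (fun _ _ => 0%N).
split=> [y z|//|//|//|y z]; rewrite !inE => /eqP -> /eqP ->.
  by rewrite !eqxx.
by rewrite v0 mulr0 mdistxx lexx.
Qed.

Lemma leveledW v alpha M M' S : (M <= M')%N ->
  leveled v alpha M S -> leveled v alpha M' S.
Proof.
move=> MM' [L [L0 Ls Lu LM Ld]]; exists L; split=> // x y xS yS.
exact: leq_trans (LM x y xS yS) MM'.
Qed.

(** All cross pairs get level [M], which dominates every level inside [A] and [B], so the
    ultrametric inequality survives. Disjointness follows from [0 < v M]. *)
Lemma leveledU v alpha M A B : (0 < M)%N -> 0 < v M ->
  {in A & B, forall x y, v M <= d x y <= alpha * v M} ->
  leveled v alpha M A -> leveled v alpha M B -> leveled v alpha M (A :|: B).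
Proof.
move=> M0 vM dAB [LA [A0 As Au AM Ad]] [LB [B0 Bs Bu BM Bd]].
have dis x : x \in A -> x \in B = false.
  move=> xA; apply/negP => xB; have := dAB x x xA xB.
  by rewrite mdistxx leNgt vM.
have inB x : x \in A :|: B -> (x \in A) = false -> x \in B.
  by rewrite inE => /orP[->|].
exists (fun x y => if x \in A then if y \in A then LA x y else M
                   else if y \in A then M else LB x y).
split.
- move=> x y xU yU; case: ifP => xA; case: ifP => yA; first exact: A0.
  + by rewrite gtn_eqF //; apply/esym/eqP => xy; rewrite xy yA in xA.
  + by rewrite gtn_eqF //; apply/esym/eqP => xy; rewrite xy yA in xA.
  + by apply: B0; exact: inB.
- move=> x y xU yU; case: ifP => xA; case: ifP => yA //; first exact: As.
  by apply: Bs; exact: inB.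
- move=> x y z xU yU zU; case: ifP => xA; case: ifP => yA; case: ifP => zA;
    rewrite ?maxnn ?leq_maxl ?leq_maxr //.
  + exact: Au.
  + exact: AM.
  + by apply: BM; exact: inB.
  + by apply: Bu; exact: inB.
- move=> x y xU yU; case: ifP => xA; case: ifP => yA //; first exact: AM.
  by apply: BM; exact: inB.
- move=> x y xU yU; case: ifP => xA; case: ifP => yA.
  + exact: Ad.
  + by apply: dAB => //; exact: inB.
  + by rewrite metric_sym; apply: dAB => //; exact: inB.
  + by apply: Bd; exact: inB.
Qed.

Definition cball X x (r : R) : {set V} := [set z in X | d x z <= r].

(* The cardinality condition on [A] and [B] is
   [sqrt #|A| + sqrt #|B| >= sqrt #|X|], squared twice. *)
Lemma ball_split (t : nat) X x y :
  x \in X -> 0 < d x y -> (2 * #|X| < 4 ^ (2 ^ t))%N ->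
  (2 * #|cball X x (d x y / (2 * t.+1%:R) * t%:R)| <= #|X|)%N ->
  exists A B, [/\ A \subset X, B \subset X, (0 < #|A|)%N, (0 < #|B|)%N
    & [/\ (#|A| + #|B| <= #|X|)%N,
          ((#|X| - (#|A| + #|B|)) ^ 2 <= 4 * (#|A| * #|B|))%N
        & {in A & B, forall p q, d x y / (2 * t.+1%:R) <= d p q}]].
Proof.
move=> xX D0 ltX half; set w := d x y / (2 * t.+1%:R).
have w0 : 0 < w by rewrite divr_gt0 // mulr_gt0 // ltr0n.
pose ball i := cball X x (w * i%:R).
have ball0 : (0 < #|ball 0%N|)%N.
  by apply/card_gt0P; exists x; rewrite inE xX mulr0 mdistxx lexx.
have ballS i j : (i <= j)%N -> ball i \subset ball j.
  move=> ij; apply/fintype.subsetP => z; rewrite !inE => /andP[-> h] /=.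
  by rewrite (le_trans h) // ler_wpM2l ?ler_nat // ltW.
have [i it slow] := slow_growth (a := fun i => #|ball i|) ball0 half ltX.
have ballX j : ball j \subset X by apply/fintype.subsetP => z; rewrite inE => /andP[].
have hi := subset_leq_card (ballS _ _ it).
have hi' := subset_leq_card (ballS i i.+1 (leqnSn i)).
have h0 := subset_leq_card (ballS 0%N i (leq0n i)).
have hd : #|X :\: ball i.+1| = (#|X| - #|ball i.+1|)%N.
  by rewrite cardsD (finset.setIidPr (ballX _)).
exists (ball i), (X :\: ball i.+1); rewrite hd.
move: half slow hi hi' h0 ball0; rewrite -/w -/(ball t).
set a := #|ball i|; set a' := #|ball i.+1|; set n := #|X| => half slow hi hi' h0 b0.
split; rewrite ?subsetDl //; try lia.
split; [lia| |].
(* Only the annulus is discarded, and [(a' - a)^2 <= a'^2 <= 2 a n <= 4 a (n - a')], the last step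
   because [2 a' <= n]. *)
- have -> : (n - (a + (n - a')) = a' - a)%N by lia.
  have : ((a' - a) ^ 2 <= a' ^ 2)%N by rewrite leq_exp2r // leq_subr.
  have : (2 * a * n <= 4 * (a * (n - a')))%N by nia.
  lia.
- move=> p q; rewrite !inE => /andP[_ hp] /andP[hq qX].
  move: hq; rewrite qX /= -ltNge -natr1 mulrDr mulr1 => hq.
  have := metric_triangle x p q; move: hp hq; lra.
Qed.

(** The largest radius, [d x y * t / (2 (t + 1))], is less than half of [d x y], so the balls about
    [x] and [y] are disjoint and one of them has at most half of the points. *)
Lemma separated_split (t : nat) X x y :
  x \in X -> y \in X -> 0 < d x y -> (2 * #|X| < 4 ^ (2 ^ t))%N ->
  exists A B, [/\ A \subset X, B \subset X, (0 < #|A|)%N, (0 < #|B|)%N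
    & [/\ (#|A| + #|B| <= #|X|)%N,
          ((#|X| - (#|A| + #|B|)) ^ 2 <= 4 * (#|A| * #|B|))%N
        & {in A & B, forall p q, d x y / (2 * t.+1%:R) <= d p q}]].
Proof.
move=> xX yX D0 ltX.
have [hx|hx] := leqP (2 * #|cball X x (d x y / (2 * t.+1%:R) * t%:R)|) #|X|.
  exact: (ball_split xX).
rewrite (metric_sym x y).
apply: (ball_split yX); rewrite -1?(metric_sym x y) //.
set Bx := cball _ _ _ in hx; set By := cball _ _ _.
have dis : Bx :&: By = finset.set0.
  apply/finset.setP => z; rewrite !inE; apply/negP => /andP[/andP[_ h1] /andP[_ h2]].
  have := metric_triangle x z y; rewrite (metric_sym z y).
  move: h1 h2; set D := d x y in D0 *; set r := _ * t%:R => h1 h2 h3.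
  have : 2 * r < D.
    have t0 : (2 * t.+1%:R : R) != 0 by rewrite mulf_neq0 ?pnatr_eq0.
    rewrite -[ltRHS](divfK t0) /r mulrCA ltr_pM2l ?ltr_pM2l ?ltr_nat //.
    by rewrite divr_gt0 // mulr_gt0 // ltr0n.
  lra.
have : (#|Bx| + #|By| <= #|X|)%N.
  rewrite -cardsUI dis cards0 addn0 subset_leq_card //.
  by apply/fintype.subsetP => z; rewrite !inE => /orP[] /andP[].
lia.
Qed.
End Metric.

(** * Dyadic scales and their residue classes *)

Section Scales.
Variable R : realType.
Implicit Types (u w D : R) (b r j : nat).

Definition scale w D : nat := trunc_log 2 (Num.truncn (D / w)).

Lemma scale_homo w D D' : 0 < w -> D <= D' -> (scale w D <= scale w D')%N.
Proof.
by move=> w0 DD'; rewrite leq_trunc_log // le_truncn // ler_pM2r ?invr_gt0.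
Qed.

Lemma scale_bounds w D : 0 < w -> w <= D ->
  w * 2 ^+ scale w D <= D < w * 2 ^+ (scale w D).+1.
Proof.
move=> w0 wD; have q1 : 1 <= D / w by rewrite ler_pdivlMr ?mul1r.
have q0 : 0 <= D / w by apply: le_trans q1.
have /andP[lo hi] := truncn_itv q0.
rewrite !(mulrC w) -ler_pdivlMr // -ltr_pdivrMr // -!natrX.
apply/andP; split.
  by apply: le_trans lo; rewrite ler_nat trunc_logP // truncn_gt0.
by apply: lt_le_trans hi _; rewrite ler_nat trunc_log_ltn.
Qed.

(* Heights are shifted by one: height [0] is reserved for distance [0]. *)
Definition rung u b r (l : nat) : R :=
  if l is j.+1 then u * 2 ^+ (r + b * j) else 0.

Lemma rung_gt0 u b r j : 0 < u -> 0 < rung u b r j.+1.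
Proof. by move=> u0; rewrite mulr_gt0 ?exprn_gt0. Qed.

(** Consecutive positive heights differ by the factor [2 ^ b >= k], which is what keeping a single
    residue modulo [b] gains. *)
Lemma rung_ratio u b r (k : R) l :
  0 < u -> 0 < k -> k <= 2 ^+ b -> rung u b r l <= rung u b r l.+1 / k.
Proof.
move=> u0 k0 kb; rewrite ler_pdivlMr //; case: l => [|j] /=.
  by rewrite mul0r mulr_ge0 ?exprn_ge0 // ltW.
by rewrite mulnS addnCA [2 ^+ (b + _)]exprD -mulrA ler_pM2l // mulrC
           ler_wpM2r ?exprn_ge0.
Qed.

End Scales.

(** In terms of square roots: [sqrt n <= sqrt a + sqrt b <= p + q]. The discarded part is at most
    [2 sqrt (a b) <= 2 p q]. *)
Lemma leq_sqr_add (n a b p q : nat) :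
  (a + b <= n)%N -> ((n - (a + b)) ^ 2 <= 4 * (a * b))%N ->
  (a <= p ^ 2)%N -> (b <= q ^ 2)%N -> (n <= (p + q) ^ 2)%N.
Proof.
move=> abn gap ap bq.
have gpq : (n - (a + b) <= 2 * (p * q))%N.
  rewrite -(@leq_exp2r _ _ 2) // (leq_trans gap) //.
  by rewrite !expnMn leq_mul2l /= leq_mul.
by rewrite sqrnD; lia.
Qed.

(** * The recursive construction of one subset per residue *)

Section Family.
Variables (R : realType) (V : finMetricType R).
Implicit Types (X A B : {set V}) (x y : V).
Local Notation d := (@mdist R V).

(* Each cluster is split at one dyadic scale [l]. The set [S r] keeps both parts
   when [l = r %[mod b]] and otherwise only the part where [S r] is larger. *)
Lemma leveled_family (b' t : nat) (u : R) :
  let b := b'.+1 in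
  0 < u -> (forall x y, x != y -> u * (2 * t.+1%:R) <= d x y) ->
  (2 * #|V| < 4 ^ (2 ^ t))%N ->
  forall X (D : R), (0 < #|X|)%N -> {in X &, forall x y, d x y <= D} ->
  exists S : 'I_b -> {set V},
    (forall r, S r \subset X /\
       leveled (rung u b r) (4 * t.+1%:R)
               (scale (u * (2 * t.+1%:R)) D %/ b).+1 (S r)) /\
    (#|X| <= (\prod_r #|S r|) ^ 2)%N.
Proof.
move=> b u0 d_ge ltV X.
have [n leXn] := ubnP #|X|; elim: n X leXn => // n IHn X leXn D X0 diamD.
set w := u * _; have w0 : 0 < w by rewrite !mulr_gt0 // ltr0n.
have [X1|X2] := leqP #|X| 1.
  have /cards1P[x ->] : #|X| == 1%N by rewrite eqn_leq X1.
  exists (fun=> [set x]); split.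
    by move=> r; split=> //; exact: leveled1.
  by rewrite cards1 expn_gt0 prodn_gt0 // => r; rewrite cards1.
have [x0 x0X] := card_gt0P X0.
have [[x y] /=] := @arg_maxP _ _ _ (x0, x0)
  (fun p => (p.1 \in X) && (p.2 \in X)) (fun p => d p.1 p.2)
  (introT andP (conj x0X x0X)).
move=> /andP[xX yX] xy_max.
have diam : {in X &, forall p q, d p q <= d x y}.
  by move=> p q pX qX; apply: (xy_max (p, q)); rewrite /= pX qX.
have xy : x != y.
  apply: contraTneq X2 => xy; rewrite -leqNgt; apply/card_le1_eqP => p q pX qX.
  have := diam p q pX qX; rewrite xy mdistxx leNgt => pq.
  by apply/eqP; apply: contraNT pq; rewrite mdist_gt0 eq_sym.
set D0 := d x y in diam.
have D0_gt0 : 0 < D0 by rewrite mdist_gt0.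
have lt_X : (2 * #|X| < 4 ^ 2 ^ t)%N.
  by apply: leq_ltn_trans ltV; rewrite leq_mul2l /= max_card.
have [A [B [AX BX A0 B0 [ABX gap sep]]]] := separated_split xX yX D0_gt0 lt_X.
have diam_sub (Y : {set V}) : Y \subset X -> {in Y &, forall p q, d p q <= D0}.
  by move=> /fintype.subsetP YX p q pY qY; apply: diam; exact: YX.
(* Both parts use the bound [D0] of the whole cluster rather than their own diameters, so their
   heights share the bound [(l %/ b).+1], the height at which they are joined. *)
have [SA [SAP prA]] := IHn A ltac:(lia) D0 A0 (diam_sub A AX).
have [SB [SBP prB]] := IHn B ltac:(lia) D0 B0 (diam_sub B BX).
set l := scale w D0 in SAP SBP.
have leM : ((l %/ b).+1 <= (scale w D %/ b).+1)%N.
  by rewrite ltnS leq_div2r // scale_homo // diamD.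
pose r0 : 'I_b := inord (l %% b).
have r0E : r0 = (l %% b)%N :> nat by rewrite inordK // ltn_pmod.
have rungE : rung u b r0 (l %/ b).+1 = u * 2 ^+ l.
  by rewrite /rung r0E mulnC addnC -divn_eq.
pose S r := if r == r0 then SA r :|: SB r
            else if (#|SA r| <= #|SB r|)%N then SB r else SA r.
(* From [w 2^l <= D0 < w 2^(l+1)] with [w = 2 (t + 1) u]: the separation [D0 / (2 (t + 1))] is at
   least [u 2^l], and [D0 < 4 (t + 1) u 2^l]. *)
have sepA p q : p \in A -> q \in B ->
    rung u b r0 (l %/ b).+1 <= d p q <= 4 * t.+1%:R * rung u b r0 (l %/ b).+1.
  move=> pA qB; rewrite rungE.
  have /andP[lo hi] := scale_bounds w0 (d_ge _ _ xy).
  have t0 : 0 < 2 * t.+1%:R :> R by rewrite mulr_gt0 // ltr0n.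
  apply/andP; split.
    apply: le_trans (sep p q pA qB); rewrite ler_pdivlMr //.
    by move: lo; rewrite /w -/D0 -/l mulrAC.
  have := diam p q (fintype.subsetP AX p pA) (fintype.subsetP BX q qB).
  move=> /le_trans -> //; apply/ltW; apply: lt_le_trans hi _.
  by rewrite -/l /w exprS le_eqVlt; apply/orP; left; apply/eqP; ring.
have dis (Y Z : {set V}) : Y \subset A -> Z \subset B -> #|Y :|: Z| = (#|Y| + #|Z|)%N.
  move=> /fintype.subsetP YA /fintype.subsetP ZB; rewrite cardsU.
  suff -> : Y :&: Z = finset.set0 by rewrite cards0 subn0.
  apply/finset.setP => z; rewrite !inE; apply/negP => /andP[/YA zA /ZB zB].
  by have /andP[] := sepA z z zA zB; rewrite mdistxx leNgt rung_gt0.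
exists S; split.
  move=> r; rewrite /S; have [SAr levA] := SAP r; have [SBr levB] := SBP r.
  have [->|_] := eqVneq r r0; last first.
    case: ifP => _; split; do ?[exact: leveledW leM _].
      exact: fintype.subset_trans SBr BX.
    exact: fintype.subset_trans SAr AX.
  have [SA0 levA0] := SAP r0; have [SB0 levB0] := SBP r0.
  split.
    by rewrite finset.subUset (fintype.subset_trans SA0 AX) (fintype.subset_trans SB0 BX).
  apply: leveledW leM _; apply: leveledU => //; first exact: rung_gt0.
  move=> p q pA qB; apply: sepA.
    exact: (fintype.subsetP SA0).
  exact: (fintype.subsetP SB0).
apply: leq_trans (leq_sqr_add ABX gap prA prB) _.
(* The factor at [r0] is a sum and every other factor a maximum, so the product for [S] is at least
   the sum of the products for [SA] and [SB]. *)
rewrite leq_exp2r // (bigD1 r0) //= [in X in (_ + X)%N](bigD1 r0) //=.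
rewrite [in leqRHS](bigD1 r0) //= {1}/S eqxx.
have [SA0 _] := SAP r0; have [SB0 _] := SBP r0.
rewrite dis // mulnDl leq_add // leq_mul2l; apply/orP; right;
  apply: leq_prod => r /negbTE rr0; rewrite /S rr0; case: ifP => //.
by move/negbT; rewrite -ltnNge => /ltnW.
Qed.
End Family.

(** * Passage to HSTs and choice of the parameters *)

Lemma leveled_HST (R : realType) (V : finMetricType R) (u alpha k : R)
    (b r M : nat) (S : {set V}) :
  0 < u -> 0 < k -> k <= 2 ^+ b -> (0 < #|S|)%N ->
  leveled (rung u b r) alpha M S ->
  exists d' : {x : V | x \in S} -> {x : V | x \in S} -> R,
    is_HST k d' /\
    approximates alpha
      (fun x y : {x : V | x \in S} => mdist (val x) (val y)) d'.
Proof.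
move=> u0 k0 kb /card_gt0P[x0 x0S] [L [L0 Ls Lu _ Ld]].
exists (fun x y => rung u b r (L (val x) (val y))); split.
  apply: (level_HST (exist _ x0 x0S)) => //.
  - by move=> i; exact: rung_gt0.
  - by move=> i; exact: rung_ratio.
  - by move=> x y; rewrite -val_eqE; apply: L0; exact: valP.
  - by move=> x y; apply: Ls; exact: valP.
  - by move=> y x z; apply: Lu; exact: valP.
by move=> x y; apply/andP; apply: Ld; exact: valP.
Qed.

Lemma min_dist (R : realType) (V : finMetricType R) :
  exists2 e : R, 0 < e & forall x y : V, x != y -> e <= mdist x y.
Proof.
(* The default [1] keeps the minimum positive when there are no two distinct points. *)
exists (\big[Order.min/1]_(p : V * V | p.1 != p.2) mdist p.1 p.2).
  by apply/bigmin_gtP; split=> // p; rewrite -mdist_gt0.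
by move=> x y xy; apply: (bigmin_le_cond _ (fun p : V * V => mdist p.1 p.2) (j := (x, y))).
Qed.

Lemma largest_factor (b' : nat) (f : 'I_b'.+1 -> nat) :
  exists r, (\prod_i f i <= f r ^ b'.+1)%N.
Proof.
exists [arg max_(i > ord0) f i]; case: arg_maxnP => // r _ fr.
have := leq_prod (fun i _ => fr i isT).
by move=> h; apply: leq_trans (h _ _) _; rewrite big_const_ord iter_muln_1.
Qed.

(** From [exp (-1/2) >= 1 - 1/2]. This crude form of [ln 2 >= 1/2] handles all changes between base
    e and base 2. *)
Lemma expR_half_le2 (R : realType) : expR (2^-1 : R) <= 2.
Proof.
have := expR_ge1Dx (- 2^-1 : R); rewrite expRN => h.
rewrite -[leRHS]invrK -[leLHS]invrK lef_pV2 ?posrE ?invr_gt0 ?expR_gt0 //.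
by apply: le_trans h; lra.
Qed.

Lemma expR_le_expr2 (R : realType) (x : R) (n : nat) :
  2 * x <= n%:R -> expR x <= 2 ^+ n.
Proof.
move=> xn; apply: (@le_trans _ _ (expR (2^-1 * n%:R))).
  by rewrite ler_expR; lra.
by rewrite mulrC expRM_natl lerXn2r ?nnegrE ?expR_ge0 // expR_half_le2.
Qed.

Lemma exists_nat_between (R : realType) (x : R) : 0 <= x ->
  exists n : nat, x <= n.+1%:R <= x + 1.
Proof.
move=> x0; exists (Num.truncn x); have /andP[lo hi] := truncn_itv x0.
by rewrite ltW //= -natr1 lerD2r.
Qed.

(** For [t] about [4 x], [2^t >= (ln n)^2 >= 2 ln n], hence [4^(2^t) >= n^2 > 2 n]. The threshold on
    [n] gives [x >= 1], so [4 (t + 1) <= 16 x + 8 <= 24 x]. *)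
Lemma loglog_depth (R : realType) (n : nat) (x := ln (ln n%:R) : R) :
  expR (expR 1) <= n%:R :> R ->
  exists t : nat, (2 * n < 4 ^ 2 ^ t)%N /\ 4 * t.+1%:R <= 24 * x.
Proof.
move=> nE.
have n0 : 0 < n%:R :> R by apply: lt_le_trans nE; exact: expR_gt0.
have e2 : 2 <= expR 1 :> R by apply: le_trans (expR_ge1Dx 1).
have lnE : expR 1 <= ln n%:R :> R by rewrite -ler_expR lnK ?posrE.
have ln0 : 0 < ln n%:R :> R by apply: lt_le_trans lnE; exact: expR_gt0.
have x1 : 1 <= x by rewrite -ler_expR lnK ?posrE.
have [t /andP[lo hi]] := @exists_nat_between _ (4 * x) ltac:(lra).
exists t.+1; split; last by move: hi; rewrite -!natr1; lra.
have pow2 : 2 * ln n%:R <= (2 ^ t.+1)%:R :> R.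
  rewrite natrX; apply: (@le_trans _ _ (expR (2 * x))).
    rewrite (expRM_natl 2) lnK ?posrE // expr2 ler_pM2r //; lra.
  by apply: expR_le_expr2; lra.
have n3 : 2 < n%:R :> R.
  apply: lt_le_trans nE; apply: (@lt_le_trans _ _ (1 + expR 1)); last exact: expR_ge1Dx.
  lra.
rewrite -(ltr_nat R) natrM; apply: (@lt_le_trans _ _ (n%:R ^+ 2)).
  by rewrite expr2 ltr_pM2r.
rewrite -{1}[n%:R]lnK ?posrE // -expRM_natl.
rewrite -[4%N]/(2 ^ 2)%N -expnM natrX; apply: expR_le_expr2.
by rewrite natrM ler_pM2l.
Qed.

Theorem theorem2p8 (R : realType) :
  exists c C : R, 0 < c /\ 0 < C /\
  exists n0 : nat,
  forall (V : finMetricType R) (n : nat), #|V| = n -> (n0 <= n)%N ->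
  forall k : R, 2 <= k ->
  exists S : {set V},
    n%:R `^ (c / ln k) <= #|S|%:R /\
    exists d' : {x : V | x \in S} -> {x : V | x \in S} -> R,
      is_HST k d' /\
      approximates (C * ln (ln n%:R))
        (fun x y : {x : V | x \in S} => mdist (val x) (val y)) d'.
Proof.
(* [24] comes from [loglog_depth]. As [ln k >= 1/2], the modulus [b'.+1 <= 2 ln k + 1] is at most
   [4 ln k], so the exponent [1 / (2 b'.+1)] is at least [1 / (8 ln k)]. *)
exists 8^-1, 24; do 2!split => //.
exists (Num.truncn (expR (expR 1) : R)).+1 => V n Vn n0n k k2.
have nE : expR (expR 1) <= n%:R :> R.
  by apply: ltW; apply: lt_le_trans (truncnS_gt _) _; rewrite ler_nat.
have [t [ltn ht]] := loglog_depth nE.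
have k0 : 0 < k by lra.
have lnk : 2^-1 <= ln k.
  by rewrite -ler_expR lnK ?posrE //; apply: le_trans (expR_half_le2 R) k2.
have [b' /andP[blo bhi]] := @exists_nat_between _ (2 * ln k) ltac:(lra).
have kb : k <= 2 ^+ b'.+1.
  by rewrite -[leLHS]lnK ?posrE //; exact: expR_le_expr2.
have [e e0 he] := min_dist V.
have t0 : 0 < 2 * t.+1%:R :> R by rewrite mulr_gt0 // ltr0n.
have u0 : 0 < e / (2 * t.+1%:R) by rewrite divr_gt0.
have V0 : (0 < #|[set: V]|)%N by rewrite cardsT Vn; apply: leq_ltn_trans n0n.
have [x y|||S [SP cardS]] := @leveled_family R V b' t _ u0 _ _ [set: V]
  (\big[Order.max/0]_(p : V * V) mdist p.1 p.2) V0 _.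
- by move=> xy; rewrite divfK ?gt_eqF ?he.
- by rewrite Vn.
- by move=> x y _ _; exact: (le_bigmax _ (fun p : V * V => mdist p.1 p.2) (x, y)).
have [r prodS] := largest_factor (fun r => #|S r|).
have {}cardS : (n <= #|S r| ^ (b'.+1 * 2))%N.
  by rewrite -Vn -cardsT (leq_trans cardS) // expnM leq_exp2r.
have Sr0 : (0 < #|S r|)%N.
  by move: cardS; case: #|S r| => // ; rewrite exp0n // leqn0 => /eqP n00; move: n0n; rewrite n00.
exists (S r); split.
  rewrite -(@ler_pXn2r _ (b'.+1 * 2)) ?nnegrE ?powR_ge0 //.
  have n1 : 1 <= n%:R :> R by rewrite ler1n; apply: leq_ltn_trans n0n.
  rewrite -powR_mulrn ?powR_ge0 // -powRrM; apply: (@le_trans _ _ n%:R).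
    rewrite -[leRHS]powRr1 ?ler0n // ler_powR // mulrAC ler_pdivrMr; last lra.
    by rewrite natrM; lra.
  by rewrite -natrX ler_nat.
have [_ lev] := SP r.
have [d' [Hd apx]] := leveled_HST u0 k0 kb Sr0 lev.
exists d'; split=> // p q; have [lo hi] := apx p q; split=> //.
rewrite (le_trans hi) // ler_wpM2r //.
(* Nonnegativity of [d' p q] is read off from [d' <= d <= 4 (t + 1) d'], since [4 (t + 1) > 1]. *)
have a1 : 0 < 4 * t.+1%:R - 1 :> R.
  have : 1 <= t.+1%:R :> R by rewrite ler1n.
  lra.
by rewrite -(pmulr_rge0 _ a1) mulrBl mul1r subr_ge0 (le_trans lo).
Qed.
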